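(* Let $k$ be a field, let $\mathcal{T}$ be a Hom-finite Krull-Schmidt triangulated $k$-category with suspension functor $\Sigma$ which has AR-triangles, and let $T\in\mathcal{T}$ be an object such that $\operatorname{Hom}_{\mathcal{T}}(T,-):\mathcal{T}\to\operatorname{mod}\Gamma$ is full and dense, where $\Gamma=\operatorname{End}_{\mathcal{T}}(T)^{\mathrm{op}}$. Let $$\Delta:\ \tau X\xrightarrow{f}Y\xrightarrow{g}X\xrightarrow{h}\Sigma\tau X$$ be an AR-triangle in $\mathcal{T}$. Assume that $X$ and $\tau X$ are both $T$-supported, that $\Sigma^{-1}X\notin\operatorname{add}T$, and that $X\notin\operatorname{add}T$. Then the functor $\operatorname{Hom}_{\mathcal{T}}(T,-)$ takes $\Delta$ to the following AR-sequence in $\operatorname{mod}\Gamma$: $$0\to\operatorname{Hom}_{\mathcal{T}}(T,\tau X)\xrightarrow{\operatorname{Hom}_{\mathcal{T}}(T,f)}\operatorname{Hom}_{\mathcal{T}}(T,Y)\xrightarrow{\operatorname{Hom}_{\mathcal{T}}(T,g)}\operatorname{Hom}_{\mathcal{T}}(T,X)\to0.$$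
   Context: An object $X$ is $T$-supported if $\operatorname{Hom}_{\mathcal{T}}(T,X)\neq0$. $\operatorname{add}T$ is the full subcategory of direct summands of finite direct sums of copies of $T$. $\operatorname{mod}\Gamma$ is the category of finitely generated (left) $\Gamma$-modules. AR-triangles and AR-sequences are Auslander-Reiten (almost split) triangles and sequences; $\tau$ is the Auslander-Reiten translation. *)

(* Defs.v *)
From HB Require Import structures.
From mathcomp Require Import all_boot all_order all_algebra.

Set Implicit Arguments.
Unset Strict Implicit.
Unset Printing Implicit Defensive.

Import GRing.Theory.
Local Open Scope ring_scope.

(* Morphisms compose from right to left: [g \oc f] is "g after f". *)

Definition finitely_generated (R : pzRingType) (M : lmodType R) : Prop :=
  exists s : seq M, forall m : M,
    exists c : 'I_(size s) -> R, m = \sum_(i < size s) c i *: s`_i.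

Record linCat (k : fieldType) := LinCat {
  Ob :> Type;
  mor : Ob -> Ob -> lmodType k;
  idm : forall X, mor X X;
  compose : forall X Y Z, mor Y Z -> mor X Y -> mor X Z;
  composeA : forall X Y Z W (h : mor Z W) (g : mor Y Z) (f : mor X Y),
    compose h (compose g f) = compose (compose h g) f;
  compose1m : forall X Y (f : mor X Y), compose (idm Y) f = f;
  composem1 : forall X Y (f : mor X Y), compose f (idm X) = f;
  compose_linearr : forall X Y Z (g : mor Y Z), linear (fun f : mor X Y => compose g f);
  compose_linearl : forall X Y Z (f : mor X Y), linear (fun g : mor Y Z => compose g f)
}.

Arguments mor {k l} X Y.
Arguments idm {k l} X.
Arguments compose {k l X Y Z} g f.
Notation "g \oc f" := (compose g f) (at level 40, left associativity).

Section LinCatTheory.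
Variables (k : fieldType) (C : linCat k).
Implicit Types X Y Z A B S T W : C.

Definition is_iso X Y (f : mor X Y) : Prop :=
  exists g : mor Y X, g \oc f = idm X /\ f \oc g = idm Y.

Definition split_epi X Y (f : mor X Y) : Prop :=
  exists s : mor Y X, f \oc s = idm Y.

Definition is_zero_object X : Prop :=
  forall Y, (forall f : mor X Y, f = 0) /\ (forall f : mor Y X, f = 0).

Definition biproduct A B S : Prop :=
  exists (i1 : mor A S) (i2 : mor B S) (p1 : mor S A) (p2 : mor S B),
    [/\ p1 \oc i1 = idm A, p2 \oc i2 = idm B, p1 \oc i2 = 0, p2 \oc i1 = 0
      & i1 \oc p1 + i2 \oc p2 = idm S].

(* For n = 0 this says that S is a zero object. *)
Definition direct_sum n (F : 'I_n -> C) S : Prop :=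
  exists (i : forall j, mor (F j) S) (p : forall j, mor S (F j)),
    [/\ forall j, p j \oc i j = idm (F j),
        forall j l, j != l -> p l \oc i j = 0
      & \sum_(j < n) i j \oc p j = idm S].

Definition indecomposable X : Prop :=
  ~ is_zero_object X /\
  forall A B, biproduct A B X -> is_zero_object A \/ is_zero_object B.

Definition local_End X : Prop :=
  idm X <> 0 /\
  forall a b : mor X X, ~ is_iso a -> ~ is_iso b -> ~ is_iso (a + b).

Definition hom_finite : Prop := forall X Y, finitely_generated (mor X Y).

Definition krull_schmidt : Prop :=
  forall X, exists n (F : 'I_n -> C),
    direct_sum F X /\ forall j, local_End (F j).

Definition in_add T X : Prop :=
  exists n X' S, direct_sum (fun _ : 'I_n => T) S /\ biproduct X X' S.

Definition supported T X : Prop := exists f : mor T X, f <> 0.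

End LinCatTheory.

Record linFunctor (k : fieldType) (C D : linCat k) := LinFunctor {
  Fobj :> C -> D;
  Fmap : forall X Y : C, {linear mor X Y -> mor (Fobj X) (Fobj Y)};
  Fmap1 : forall X : C, Fmap X X (idm X) = idm (Fobj X);
  FmapM : forall (X Y Z : C) (g : mor Y Z) (f : mor X Y),
    Fmap X Z (g \oc f) = Fmap Y Z g \oc Fmap X Y f
}.

Arguments Fmap {k C D} F {X Y} : rename.

(* Sigma is an autoequivalence with chosen quasi-inverse SigmaV, not
   necessarily an automorphism. *)
Record triCat (k : fieldType) := TriCat {
  tcat :> linCat k;
  zero_obj : tcat;
  zero_objP : is_zero_object zero_obj;
  biproduct_ex : forall A B : tcat, exists S : tcat, biproduct A B S;
  Sigma : linFunctor tcat tcat;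
  SigmaV : linFunctor tcat tcat;
  SigmaK : exists e : forall X : tcat, mor X (SigmaV (Sigma X)),
    (forall X, is_iso (e X)) /\
    (forall (X Y : tcat) (f : mor X Y), Fmap SigmaV (Fmap Sigma f) \oc e X = e Y \oc f);
  SigmaVK : exists e : forall X : tcat, mor (Sigma (SigmaV X)) X,
    (forall X, is_iso (e X)) /\
    (forall (X Y : tcat) (f : mor X Y), e Y \oc Fmap Sigma (Fmap SigmaV f) = f \oc e X);
  distinguished : forall X Y Z : tcat, mor X Y -> mor Y Z -> mor Z (Sigma X) -> Prop;
  tr1_id : forall X : tcat,
    distinguished (idm X) (0 : mor X zero_obj) (0 : mor zero_obj (Sigma X));
  tr1_cone : forall (X Y : tcat) (f : mor X Y),
    exists (Z : tcat) (g : mor Y Z) (h : mor Z (Sigma X)), distinguished f g h;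
  tr1_iso : forall (X Y Z X' Y' Z' : tcat)
    (f : mor X Y) (g : mor Y Z) (h : mor Z (Sigma X))
    (f' : mor X' Y') (g' : mor Y' Z') (h' : mor Z' (Sigma X'))
    (a : mor X X') (b : mor Y Y') (c : mor Z Z'),
    is_iso a -> is_iso b -> is_iso c ->
    b \oc f = f' \oc a -> c \oc g = g' \oc b -> Fmap Sigma a \oc h = h' \oc c ->
    distinguished f g h -> distinguished f' g' h';
  tr2 : forall (X Y Z : tcat) (f : mor X Y) (g : mor Y Z) (h : mor Z (Sigma X)),
    distinguished f g h <-> distinguished g h (- Fmap Sigma f);
  tr3 : forall (X Y Z X' Y' Z' : tcat)
    (f : mor X Y) (g : mor Y Z) (h : mor Z (Sigma X))
    (f' : mor X' Y') (g' : mor Y' Z') (h' : mor Z' (Sigma X'))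
    (a : mor X X') (b : mor Y Y'),
    distinguished f g h -> distinguished f' g' h' -> b \oc f = f' \oc a ->
    exists c : mor Z Z', c \oc g = g' \oc b /\ Fmap Sigma a \oc h = h' \oc c;
  tr4 : forall (X Y Z Z' X' Y' : tcat) (f : mor X Y) (g : mor Y Z)
    (i : mor Y Z') (i' : mor Z' (Sigma X))
    (j : mor Z X') (j' : mor X' (Sigma Y))
    (l : mor Z Y') (l' : mor Y' (Sigma X)),
    distinguished f i i' -> distinguished g j j' -> distinguished (g \oc f) l l' ->
    exists (u : mor Z' Y') (v : mor Y' X'),
      distinguished u v (Fmap Sigma i \oc j') /\
      [/\ u \oc i = l \oc g, l' \oc u = i', v \oc l = j
        & j' \oc v = Fmap Sigma f \oc l']
}.

Arguments Sigma {k t}.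
Arguments SigmaV {k t}.
Arguments distinguished {k t X Y Z} f g h.

Section ARTriangles.
Variables (k : fieldType) (C : triCat k).

Definition AR_triangle (A B Z : C)
    (f : mor A B) (g : mor B Z) (h : mor Z (Sigma A)) : Prop :=
  [/\ distinguished f g h, indecomposable A, indecomposable Z, h <> 0
    & forall (W : C) (u : mor W Z), ~ split_epi u ->
        exists v : mor W B, u = g \oc v].

Definition has_AR_triangles : Prop :=
  forall Z : C, indecomposable Z ->
    exists (A B : C) (f : mor A B) (g : mor B Z) (h : mor Z (Sigma A)),
      AR_triangle f g h.

(* tau is determined up to isomorphism on indecomposable objects; its values
   on the other objects are left free. *)
Definition AR_translation (tau : C -> C) : Prop :=
  forall Z : C, indecomposable Z ->
    exists (B : C) (f : mor (tau Z) B) (g : mor B Z) (h : mor Z (Sigma (tau Z))),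
      AR_triangle f g h.

End ARTriangles.

(* [End_ring T] carries the composition product (a * b is "a after b"); its
   converse ring Gamma acts on Hom(T, X) on the left by precomposition. *)
Section HomFunctor.
Variables (k : fieldType) (C : linCat k) (T : C).

Definition End_ring : Type := mor T T.

HB.instance Definition _ := GRing.Zmodule.on End_ring.

Lemma compose_Dr (X Y Z : C) (g : mor Y Z) (f f' : mor X Y) :
  g \oc (f + f') = g \oc f + g \oc f'.
Proof. by have := compose_linearr g 1 f f'; rewrite !scale1r. Qed.

Lemma compose_Dl (X Y Z : C) (g g' : mor Y Z) (f : mor X Y) :
  (g + g') \oc f = g \oc f + g' \oc f.
Proof. by have := compose_linearl f 1 g g'; rewrite !scale1r. Qed.

Definition End_mul (a b : End_ring) : End_ring := compose (a : mor T T) (b : mor T T).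

Fact End_mulA : associative End_mul.
Proof. by move=> a b c; apply: composeA. Qed.
Fact End_mul1r : left_id (idm T : End_ring) End_mul.
Proof. by move=> a; apply: compose1m. Qed.
Fact End_mulr1 : right_id (idm T : End_ring) End_mul.
Proof. by move=> a; apply: composem1. Qed.
Fact End_mulDl : left_distributive End_mul +%R.
Proof. by move=> a b c; apply: compose_Dl. Qed.
Fact End_mulDr : right_distributive End_mul +%R.
Proof. by move=> a b c; apply: compose_Dr. Qed.

HB.instance Definition _ := GRing.Zmodule_isPzRing.Build End_ring
  End_mulA End_mul1r End_mulr1 End_mulDl End_mulDr.

Definition Gamma : pzRingType := End_ring^c.

Definition homT (X : C) : Type := mor T X.

HB.instance Definition _ (X : C) := GRing.Zmodule.on (homT X).

Definition homT_scale (X : C) (a : Gamma) (x : homT X) : homT X :=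
  compose (x : mor T X) (a : mor T T).

Fact homT_scaleA (X : C) (a b : Gamma) (x : homT X) :
  homT_scale a (homT_scale b x) = homT_scale (a * b) x.
Proof. by rewrite /homT_scale -composeA. Qed.
Fact homT_scale1 (X : C) : left_id (1 : Gamma) (@homT_scale X).
Proof. by move=> x; apply: composem1. Qed.
Fact homT_scaleDr (X : C) : right_distributive (@homT_scale X) +%R.
Proof. by move=> a x y; apply: compose_Dl. Qed.
Fact homT_scaleDl (X : C) (x : homT X) :
  {morph (@homT_scale X)^~ x : a b / a + b}.
Proof. by move=> a b; apply: compose_Dr. Qed.

HB.instance Definition _ (X : C) :=
  GRing.Zmodule_isLmodule.Build Gamma (homT X)
    (@homT_scaleA X) (@homT_scale1 X) (@homT_scaleDr X) (@homT_scaleDl X).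

Definition homT_map (X Y : C) (f : mor X Y) (x : homT X) : homT Y :=
  compose f (x : mor T X).

Fact homT_map_linear (X Y : C) (f : mor X Y) : linear (homT_map f).
Proof.
move=> a x y; rewrite /homT_map compose_Dr; congr (_ + _).
exact: composeA.
Qed.

HB.instance Definition _ (X Y : C) (f : mor X Y) :=
  GRing.isLinear.Build Gamma (homT X) (homT Y) *:%R (homT_map f)
    (homT_map_linear f).

Definition homT_full : Prop :=
  forall (X Y : C) (phi : {linear homT X -> homT Y}),
    exists f : mor X Y, phi =1 homT_map f.

Definition homT_dense : Prop :=
  forall M : lmodType Gamma, finitely_generated M ->
    exists (X : C) (phi : {linear homT X -> M}), bijective phi.

End HomFunctor.

Arguments homT_map {k C} T {X Y} f x.

Section ARSequences.
Variables (R : pzRingType) (A B Z : lmodType R).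

Definition mod_split_mono (M N : lmodType R) (f : {linear M -> N}) : Prop :=
  exists r : {linear N -> M}, cancel f r.

Definition mod_split_epi (M N : lmodType R) (f : {linear M -> N}) : Prop :=
  exists s : {linear N -> M}, cancel s f.

Definition short_exact (f : {linear A -> B}) (g : {linear B -> Z}) : Prop :=
  [/\ injective f, forall b, g b = 0 <-> exists a, f a = b
    & forall z, exists b, g b = z].

Definition left_almost_split (f : {linear A -> B}) : Prop :=
  ~ mod_split_mono f /\
  forall (W : lmodType R) (u : {linear A -> W}), finitely_generated W ->
    ~ mod_split_mono u -> exists v : {linear B -> W}, u =1 v \o f.

Definition right_almost_split (g : {linear B -> Z}) : Prop :=
  ~ mod_split_epi g /\
  forall (W : lmodType R) (u : {linear W -> Z}), finitely_generated W ->
    ~ mod_split_epi u -> exists v : {linear W -> B}, u =1 g \o v.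

(* Auslander-Reiten sequence in the category of finitely generated left
   R-modules. *)
Definition AR_sequence (f : {linear A -> B}) (g : {linear B -> Z}) : Prop :=
  [/\ finitely_generated A, finitely_generated B & finitely_generated Z] /\
  [/\ short_exact f g, left_almost_split f & right_almost_split g].

End ARSequences.

(* Main.v *)
Require Import Defs.
From HB Require Import structures.
From mathcomp Require Import all_boot all_order all_algebra.
From Stdlib Require Import Classical.
Local Open Scope ring_scope.

Set Implicit Arguments.
Unset Strict Implicit.
Unset Printing Implicit Defensive.
Import GRing.Theory.

(** The functor [F = Hom(T, -)] is not faithful, so the almost split
    properties cannot simply be transported along it; what saves the argument
    is that the two end terms have local endomorphism rings and are not
    killed by [F].

    Exactness.  A morphism [T -> X] that is not a split epimorphism lifts
    through [g], and a split epimorphism would make [X] a summand of [T]; so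
    [F g] is onto.  If [f t = 0] for some [t : T -> tau X], then [Sigma t]
    factors as [h s] with [s : Sigma T -> X].  If [t] is nonzero then [s] does
    not lift through [g], so it is a split epimorphism, and [Sigma^-1 X] is a
    summand of [T].  Hence [F f] is injective ([homT_map_inj]).

    Almost split properties.  Since [F] is full and dense, every module map
    into [F X] or out of [F (tau X)] is, up to isomorphism, the image of a
    morphism of the triangulated category, and splittings of that morphism are
    sent to splittings; so the factorizations exist downstairs because they
    exist upstairs.  Upstairs, [g] is right almost split by definition, and
    [f] is left almost split by [AR_left_almost_split].  It remains to see that
    [F g] and [F f] do not split.  By fullness a splitting would give an
    endomorphism [a = g s] of [X] (or [a = r f] of [tau X]) with [F a = 1].
    Were [a] not invertible, [1 - a] would be, by locality, an isomorphism
    killed by [F], contradicting supportedness ([homT_id_iso]); so [a] is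
    invertible, [g] or [f] splits, and the connecting morphism [h] vanishes,
    which is absurd.

    Locality of the endomorphism rings is obtained from the decomposition
    into objects with local endomorphism rings, because a split monomorphism in
    a triangulated category has a complement ([split_mono_biproduct]). *)

(** * Linear categories *)

Section LinCat.
Variables (k : fieldType) (C : linCat k).
Implicit Types X Y Z : C.

Lemma comp0m X Y Z (f : mor X Y) : (0 : mor Y Z) \oc f = 0.
Proof. by apply: (@addrI _ (0 \oc f)); rewrite -compose_Dl !addr0. Qed.

Lemma compm0 X Y Z (g : mor Y Z) : g \oc (0 : mor X Y) = 0.
Proof. by apply: (@addrI _ (g \oc 0)); rewrite -compose_Dr !addr0. Qed.

Lemma compNm X Y Z (g : mor Y Z) (f : mor X Y) : (- g) \oc f = - (g \oc f).
Proof. by apply: (@addrI _ (g \oc f)); rewrite -compose_Dl !subrr comp0m. Qed.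

Lemma compmN X Y Z (g : mor Y Z) (f : mor X Y) : g \oc (- f) = - (g \oc f).
Proof. by apply: (@addrI _ (g \oc f)); rewrite -compose_Dr !subrr compm0. Qed.

Lemma compBm X Y Z (g g' : mor Y Z) (f : mor X Y) :
  (g - g') \oc f = g \oc f - g' \oc f.
Proof. by rewrite compose_Dl compNm. Qed.

Lemma compmB X Y Z (g : mor Y Z) (f f' : mor X Y) :
  g \oc (f - f') = g \oc f - g \oc f'.
Proof. by rewrite compose_Dr compmN. Qed.

Lemma compmZ X Y Z (c : k) (g : mor Y Z) (f : mor X Y) :
  g \oc (c *: f) = c *: (g \oc f).
Proof. by have := compose_linearr g c f 0; rewrite !addr0 compm0 addr0. Qed.

Lemma idm_iso X : is_iso (idm X).
Proof. by exists (idm X); rewrite compose1m. Qed.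

Lemma iso_comp X Y Z (g : mor Y Z) (f : mor X Y) :
  is_iso g -> is_iso f -> is_iso (g \oc f).
Proof.
move=> [g' [g'g gg']] [f' [f'f ff']]; exists (f' \oc g'); split.
  by rewrite composeA -(composeA f') g'g composem1.
by rewrite composeA -(composeA g) ff' composem1.
Qed.

Lemma iso_comp_eq0 X Y Z (a : mor Y Z) (u : mor X Y) :
  is_iso a -> a \oc u = 0 -> u = 0.
Proof.
by move=> [b [ba _]] au0; rewrite -(compose1m u) -ba -composeA au0 compm0.
Qed.

Lemma comp_iso_eq0 X Y Z (a : mor X Y) (u : mor Y Z) :
  is_iso a -> u \oc a = 0 -> u = 0.
Proof.
by move=> [b [_ ab]] ua0; rewrite -(composem1 u) -ab composeA ua0 comp0m.
Qed.

Lemma id0_zero_object X : idm X = 0 -> is_zero_object X.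
Proof.
move=> X0 Y; split=> f; first by rewrite -(composem1 f) X0 compm0.
by rewrite -(compose1m f) X0 comp0m.
Qed.

Lemma zero_object_iso X Y (f : mor X Y) :
  is_zero_object X -> is_zero_object Y -> is_iso f.
Proof.
move=> X0 Y0; exists 0; split.
  by rewrite (proj1 (X0 X) (0 \oc f)) (proj1 (X0 X) (idm X)).
by rewrite (proj1 (Y0 Y) (f \oc 0)) (proj1 (Y0 Y) (idm Y)).
Qed.

Lemma direct_sum1 X : direct_sum (fun _ : 'I_1 => X) X.
Proof.
exists (fun=> idm X), (fun=> idm X); split=> [j|j l|].
- exact: compose1m.
- by rewrite (ord1 j) (ord1 l).
- by rewrite big_ord1 compose1m.
Qed.

Lemma local_End_sub_iso X (a : mor X X) :
  local_End X -> ~ is_iso a -> is_iso (idm X - a).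
Proof.
move=> [_ locX] nia; apply: NNPP => nib.
by case: (locX _ _ nia nib); rewrite addrC subrK; apply: idm_iso.
Qed.

Lemma local_End_iso X Y (i : mor X Y) : is_iso i -> local_End X -> local_End Y.
Proof.
move=> isoi [X1 locX]; have [p [pi1 ip1]] := isoi.
have isop : is_iso p by exists i.
have conjK a : i \oc (p \oc a \oc i) \oc p = a.
  by rewrite -!composeA ip1 composem1 composeA ip1 compose1m.
split=> [Y0|a b nia nib isoab].
  by apply: X1; rewrite -pi1 -(compose1m i) Y0 comp0m compm0.
apply: (locX (p \oc a \oc i) (p \oc b \oc i)).
- by move=> isoa; apply: nia; rewrite -(conjK a); do 2?apply: iso_comp.
- by move=> isob; apply: nib; rewrite -(conjK b); do 2?apply: iso_comp.
rewrite -compose_Dl -compose_Dr.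
by do 2?apply: iso_comp.
Qed.

End LinCat.

Section LinFunctor.
Variables (k : fieldType) (C D : linCat k) (F : linFunctor C D).
Implicit Types X Y : C.

Lemma Fmap_zero_object X :
  is_zero_object X -> is_zero_object (F X).
Proof.
move=> X0; apply: id0_zero_object.
by rewrite -Fmap1 (proj1 (X0 X) (idm X)) raddf0.
Qed.

Lemma Fmap_iso X Y (f : mor X Y) :
  is_iso f -> is_iso (Fmap F f).
Proof.
by move=> [g [gf fg]]; exists (Fmap F g); rewrite -!FmapM gf fg !Fmap1.
Qed.

End LinFunctor.

(** * Triangles *)

Section Triangulated.
Variables (k : fieldType) (C : triCat k).
Implicit Types A B X Y Z W : C.

Lemma Sigma_inj X Y (a b : mor X Y) :
  Fmap Sigma a = Fmap Sigma b -> a = b.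
Proof.
have [e [isoe nat]] := SigmaK C => ab.
apply/eqP; rewrite -subr_eq0; apply/eqP.
by apply: (iso_comp_eq0 (isoe Y)); rewrite compmB -!nat ab subrr.
Qed.

Lemma SigmaV_inj X Y (a b : mor X Y) :
  Fmap SigmaV a = Fmap SigmaV b -> a = b.
Proof.
have [e [isoe nat]] := SigmaVK C => ab.
apply/eqP; rewrite -subr_eq0; apply/eqP.
by apply: (comp_iso_eq0 (isoe X)); rewrite compBm -!nat ab subrr.
Qed.

Lemma Sigma_full X Y (c : mor (Sigma X) (Sigma Y)) :
  exists w : mor X Y, c = Fmap Sigma w.
Proof.
have [e [isoe nat]] := SigmaK C.
have [e' [e'e ee']] := isoe Y.
exists (e' \oc (Fmap SigmaV c \oc e X)); apply: SigmaV_inj.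
apply/eqP; rewrite -subr_eq0; apply/eqP; apply: (comp_iso_eq0 (isoe X)).
by rewrite compBm nat composeA ee' compose1m subrr.
Qed.

Lemma triangle_comp0 X Y Z (f : mor X Y) (g : mor Y Z) (h : mor Z (Sigma X)) :
  distinguished f g h -> g \oc f = 0.
Proof.
move=> fgh; have [c [cE _]] := tr3 (tr1_id X) fgh (erefl (f \oc idm X)).
by rewrite -cE compm0.
Qed.

Lemma triangle_comp0r X Y Z (f : mor X Y) (g : mor Y Z) (h : mor Z (Sigma X)) :
  distinguished f g h -> h \oc g = 0.
Proof. by move=> /tr2 /triangle_comp0. Qed.

Lemma triangle_comp0s X Y Z (f : mor X Y) (g : mor Y Z) (h : mor Z (Sigma X)) :
  distinguished f g h -> Fmap Sigma f \oc h = 0.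
Proof.
by move=> /tr2 /tr2 /triangle_comp0 /eqP; rewrite compNm oppr_eq0 => /eqP.
Qed.

(** Exactness of [Hom(W, -)] at the middle term: the rotated identity triangle
    of [W] maps to the rotated triangle, and the resulting filler descends along
    [Sigma], which is fully faithful. *)
Lemma triangle_lift X Y Z (f : mor X Y) (g : mor Y Z) (h : mor Z (Sigma X))
    W (v : mor W Y) :
  distinguished f g h -> g \oc v = 0 -> exists w, v = f \oc w.
Proof.
move=> /tr2 fgh gv0; have /tr2 idW := tr1_id W.
have sq : (0 : mor (zero_obj C) Z) \oc 0 = g \oc v by rewrite gv0 comp0m.
have [c [_]] := tr3 idW fgh sq; have [w ->] := Sigma_full c.
rewrite compmN compNm Fmap1 composem1 => /oppr_inj; rewrite -FmapM.
by exists w; apply: Sigma_inj.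
Qed.

Lemma triangle_0id W :
  distinguished (0 : mor (zero_obj C) W) (idm W) 0.
Proof.
apply/tr2; rewrite raddf0 oppr0.
have z0 := Fmap_zero_object Sigma (@zero_objP _ C).
apply: (tr1_iso (a := idm W) (b := idm W) (c := 0)) (tr1_id W) => //.
- exact: idm_iso.
- exact: idm_iso.
- exact: zero_object_iso (@zero_objP _ C) z0.
- by rewrite !comp0m.
- by rewrite compm0 comp0m.
Qed.

(** Exactness of [Hom(-, W)] at the middle term, by comparison with the triangle
    on the identity of [W] starting at a zero object. *)
Lemma triangle_extend X Y Z (f : mor X Y) (g : mor Y Z) (h : mor Z (Sigma X))
    W (u : mor Y W) :
  distinguished f g h -> u \oc f = 0 -> exists w, u = w \oc g.
Proof.
move=> fgh uf0.
have sq : u \oc f = (0 : mor (zero_obj C) W) \oc 0 by rewrite uf0 comp0m.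
have [c [cE _]] := tr3 fgh (triangle_0id W) sq.
by exists c; rewrite cE compose1m.
Qed.

(** The cone of a split monomorphism has zero connecting morphism, so its
    projection onto the cone splits as well; correcting the section to be
    killed by [p] makes the cone a complement. *)
Lemma split_mono_biproduct A B (i : mor A B) (p : mor B A) :
  p \oc i = idm A ->
  exists Z (i2 : mor Z B) (p2 : mor B Z),
    [/\ p2 \oc i2 = idm Z, p \oc i2 = 0, p2 \oc i = 0
      & i \oc p + i2 \oc p2 = idm B].
Proof.
move=> pi1; have [Z [q [r D]]] := tr1_cone i.
have r0 : r = 0.
  by rewrite -(compose1m r) -Fmap1 -pi1 FmapM -composeA (triangle_comp0s D) compm0.
have [s qs] : exists s, idm Z = q \oc s.
  by apply: triangle_lift (proj1 (tr2 _ _ _) D) _; rewrite r0 comp0m.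
have qi := triangle_comp0 D.
pose s' := s - i \oc (p \oc s).
have ps' : p \oc s' = 0 by rewrite compmB composeA pi1 compose1m subrr.
have qs' : q \oc s' = idm Z by rewrite compmB composeA qi comp0m subr0.
exists Z, s', q; split=> //.
have [t tE] : exists t, idm B - i \oc p - s' \oc q = i \oc t.
  apply: triangle_lift D _.
  by rewrite !compmB !composeA composem1 qi comp0m subr0 qs' compose1m subrr.
have t0 : t = 0.
  rewrite -(compose1m t) -pi1 -composeA -tE !compmB !composeA pi1 ps'.
  by rewrite composem1 compose1m comp0m subrr subr0.
apply/eqP; rewrite eq_sym -subr_eq0; apply/eqP.
by rewrite opprD addrA tE t0 compm0.
Qed.

Lemma retract_in_add T X (i : mor X T) (p : mor T X) :
  p \oc i = idm X -> in_add T X.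
Proof.
move=> pi1; have [Z [i2 [p2 [? ? ? ?]]]] := split_mono_biproduct pi1.
exists 1%N, Z, T; split; first exact: direct_sum1.
by exists i, i2, p, p2.
Qed.

(** A first summand [F ord0] with local endomorphism ring is nonzero, so its
    complement must vanish and [X] is isomorphic to [F ord0]. *)
Lemma indecomposable_local X :
  krull_schmidt C -> indecomposable X -> local_End X.
Proof.
move=> KS [nzX indX]; have [[|n] [F [[i [p [pi1 _ sumE]]] locF]]] := KS X.
  by case: nzX; apply: id0_zero_object; rewrite -sumE big_ord0.
have [Z [i2 [p2 [p2i2 pi2 p2i id2]]]] := split_mono_biproduct (pi1 ord0).
have [|F0|Z0] := indX (F ord0) Z; first by exists (i ord0), i2, (p ord0), p2.
  by case: (locF ord0) => -[]; rewrite (proj1 (F0 _) (idm _)).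
apply: (@local_End_iso _ _ (F ord0) _ (i ord0)) (locF ord0).
exists (p ord0); split=> //.
by rewrite -id2 (proj1 (Z0 _) i2) comp0m addr0.
Qed.

Lemma AR_triangle_not_split_epi X Y Z
    (f : mor X Y) (g : mor Y Z) (h : mor Z (Sigma X)) :
  AR_triangle f g h -> ~ split_epi g.
Proof.
move=> [D _ _ hn0 _] [s gs]; apply: hn0.
by rewrite -(composem1 h) -gs composeA (triangle_comp0r D) comp0m.
Qed.

Lemma AR_triangle_not_split_mono X Y Z
    (f : mor X Y) (g : mor Y Z) (h : mor Z (Sigma X)) (r : mor Y X) :
  AR_triangle f g h -> r \oc f <> idm X.
Proof.
move=> [D _ _ hn0 _] rf; apply: hn0.
rewrite -(compose1m h) -Fmap1 -rf FmapM -composeA (triangle_comp0s D).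
exact: compm0.
Qed.

(** Let [w = Sigma u h].  If [w = 0] then [u] factors through [f].  Otherwise the
    morphism [e : E -> Z] preceding [w] in a triangle is not a split
    epimorphism, so it lifts through [g] and is killed by [h]; hence [h] factors
    through [w], say [h = Sigma (r u) h].  As [h] is nonzero, [1 - r u] is not
    invertible, so [r u] is, by locality. *)
Lemma AR_left_almost_split X Y Z
    (f : mor X Y) (g : mor Y Z) (h : mor Z (Sigma X)) W (u : mor X W) :
  krull_schmidt C -> AR_triangle f g h ->
  (forall r : mor W X, r \oc u <> idm X) ->
  exists v, u = v \oc f.
Proof.
move=> KS [D indX indZ hn0 ras] nsu.
have locX := indecomposable_local KS indX.
pose w := Fmap Sigma u \oc h.
have [w0|wn0] := classic (w = 0).
  have [c cE] := triangle_extend (proj1 (tr2 _ _ _) (proj1 (tr2 _ _ _) D)) w0.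
  have [v vE] := Sigma_full c.
  exists (- v); apply: Sigma_inj.
  by rewrite cE vE compmN -FmapM compNm raddfN.
have [V [p [q DV]]] := tr1_cone w.
have [eps [isoeps _]] := SigmaVK C.
have [e eE] := Sigma_full (q \oc eps V).
have we0 : w \oc e = 0.
  apply: Sigma_inj.
  by rewrite FmapM -eE composeA (triangle_comp0s DV) comp0m raddf0.
have he0 : h \oc e = 0.
  have [v ->] : exists v, e = g \oc v.
    apply: ras => -[s es]; apply: wn0.
    by rewrite -(composem1 w) -es composeA we0 comp0m.
  by rewrite composeA (triangle_comp0r D) comp0m.
have hq0 : Fmap Sigma h \oc q = 0.
  apply: (comp_iso_eq0 (isoeps V)).
  by rewrite -composeA eE -FmapM he0 raddf0.
have [c cE] := triangle_extend (proj1 (tr2 _ _ _) (proj1 (tr2 _ _ _) DV)) hq0.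
have [c1 c1E] := Sigma_full c; have [r rE] := Sigma_full c1.
(* The sign is the one that rotation puts on [Sigma w]. *)
have hE : h = Fmap Sigma (- r \oc u) \oc h.
  apply: Sigma_inj.
  by rewrite cE c1E rE compmN -!FmapM -raddfN -compNm -raddfN composeA -FmapM.
have [isoru|nisoru] := classic (is_iso (- r \oc u)).
  have [b [bru _]] := isoru.
  by case: (nsu (b \oc - r)); rewrite -composeA.
case: hn0; apply: (iso_comp_eq0 (a := Fmap Sigma (idm X - (- r \oc u)))).
  by apply: Fmap_iso; apply: local_End_sub_iso.
by rewrite linearB Fmap1 compBm compose1m -hE subrr.
Qed.

End Triangulated.

(** * The functor Hom(T, -) *)

Lemma linear_inverse (R : pzRingType) (M N : lmodType R) (phi : {linear M -> N}) :
  bijective phi ->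
  exists psi : {linear N -> M}, cancel phi psi /\ cancel psi phi.
Proof.
move=> [psi phiK psiK]; have lin := can2_linear phiK psiK.
pose L := GRing.isLinear.Build R N M *:%R psi lin.
by exists (HB.pack psi L : {linear N -> M}).
Qed.

Section HomT.
Variables (k : fieldType) (C : triCat k) (T : C).
Implicit Types X Y Z : C.

(** A spanning set over [k] generates over [Gamma], since the scalar [c] acts as
    the endomorphism [c *: idm T]. *)
Lemma homT_fg X : hom_finite C -> finitely_generated (homT T X).
Proof.
move=> Hfin; have [s gen] := Hfin T X; exists s => m.
have [c mE] := gen m; exists (fun i => (c i *: idm T : mor T T)).
rewrite {1}mE; apply: eq_bigr => i _.
by rewrite -[RHS]/((s`_i : mor T X) \oc _) compmZ composem1.
Qed.

(** [Hom(T, -)] reflects identities up to isomorphism here: if [a] were not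
    invertible then [1 - a] would be, and every [x : T -> X] satisfies
    [(1 - a) x = 0]. *)
Lemma homT_id_iso X (a : mor X X) :
  local_End X -> supported T X -> (forall x : homT T X, homT_map T a x = x) ->
  is_iso a.
Proof.
move=> locX [x xn0] aid; apply: NNPP => nia; apply: xn0.
apply: (iso_comp_eq0 (local_End_sub_iso locX nia)).
by rewrite compBm compose1m; apply/eqP; rewrite subr_eq0 eq_sym; apply/eqP/aid.
Qed.

Lemma homT_map_inj X Y Z (f : mor X Y) (g : mor Y Z) (h : mor Z (Sigma X)) :
  AR_triangle f g h -> ~ in_add T (SigmaV Z) -> injective (homT_map T f).
Proof.
move=> [D _ _ _ ras] HZ; suff ker0 (t : mor T X) : f \oc t = 0 -> t = 0.
  move=> x y fxy; apply/eqP; rewrite -subr_eq0; apply/eqP/ker0.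
  by rewrite compmB; apply/eqP; rewrite subr_eq0; apply/eqP.
move=> ft0.
have [s sE] : exists s, Fmap Sigma t = h \oc s.
  apply: triangle_lift (proj1 (tr2 _ _ _) (proj1 (tr2 _ _ _) D)) _.
  by rewrite compNm -FmapM ft0 raddf0 oppr0.
have [[j sj]|nss] := classic (split_epi s); last first.
  apply: Sigma_inj; have [v vE] := ras _ _ nss.
  by rewrite sE vE composeA (triangle_comp0r D) comp0m raddf0.
case: HZ; have [e [isoe _]] := SigmaK C; have [e' [e'e ee']] := isoe T.
apply: (@retract_in_add _ _ _ _ (e' \oc Fmap SigmaV j) (Fmap SigmaV s \oc e T)).
by rewrite composeA -(composeA _ (e T)) ee' composem1 -FmapM sj Fmap1.
Qed.

Lemma homT_short_exact X Y Z (f : mor X Y) (g : mor Y Z) (h : mor Z (Sigma X)) :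
  AR_triangle f g h -> ~ in_add T (SigmaV Z) -> ~ in_add T Z ->
  short_exact (homT_map T f) (homT_map T g).
Proof.
move=> AR HSZ HZ; have [D _ _ _ ras] := AR; split.
- exact: homT_map_inj AR HSZ.
- move=> y; split=> [gy0|[x <-]].
    by have [x xE] := triangle_lift D gy0; exists x.
  by rewrite /= /homT_map composeA (triangle_comp0 D) comp0m.
- move=> z; have [|y yE] := ras T z; last by exists y.
  by move=> [i zi]; apply: HZ; apply: retract_in_add zi.
Qed.

Lemma homT_right_almost_split X Y Z
    (f : mor X Y) (g : mor Y Z) (h : mor Z (Sigma X)) :
  krull_schmidt C -> homT_full T -> homT_dense T -> AR_triangle f g h ->
  supported T Z -> right_almost_split (homT_map T g).
Proof.
move=> KS full dense AR suppZ; have [_ _ indZ _ ras] := AR.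
split=> [[s gsK]|M u fgM nsu].
  have [s' s'E] := full _ _ s.
  have [|b [_ gsb]] := @homT_id_iso _ (g \oc s') (indecomposable_local KS indZ) suppZ.
    by move=> x; rewrite /homT_map -composeA -[s' \oc _]s'E; apply: gsK.
  by apply: (AR_triangle_not_split_epi AR); exists (s' \oc b); rewrite composeA.
have [W [phi phi_bij]] := dense M fgM.
have [psi [phiK psiK]] := linear_inverse phi_bij.
have [u' u'E] := full _ _ (u \o phi).
have [|v vE] := ras W u'.
  move=> [s us]; apply: nsu; exists (phi \o homT_map T s) => x.
  by rewrite /= [LHS]u'E /homT_map composeA us compose1m.
exists (homT_map T v \o psi) => m.
by rewrite /= -{1}(psiK m) [LHS]u'E vE /homT_map composeA.
Qed.

Lemma homT_left_almost_split X Y Z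
    (f : mor X Y) (g : mor Y Z) (h : mor Z (Sigma X)) :
  krull_schmidt C -> homT_full T -> homT_dense T -> AR_triangle f g h ->
  supported T X -> left_almost_split (homT_map T f).
Proof.
move=> KS full dense AR suppX; have [_ indX _ _ _] := AR.
split=> [[r rfK]|M u fgM nsu].
  have [r' r'E] := full _ _ r.
  have [|b [brf _]] := @homT_id_iso _ (r' \oc f) (indecomposable_local KS indX) suppX.
    by move=> x; rewrite /homT_map -composeA -[r' \oc _]r'E; apply: rfK.
  by apply: (AR_triangle_not_split_mono (r := b \oc r') AR); rewrite -composeA.
have [W [phi phi_bij]] := dense M fgM.
have [psi [phiK psiK]] := linear_inverse phi_bij.
have [u' u'E] := full _ _ (psi \o u).
have [|v vE] := AR_left_almost_split (u := u') KS AR.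
  move=> r ru; apply: nsu; exists (homT_map T r \o psi) => x.
  by rewrite /= [psi _]u'E /homT_map composeA ru compose1m.
exists (phi \o homT_map T v) => x.
by rewrite /= -(psiK (u x)) [psi _]u'E vE /homT_map composeA.
Qed.

End HomT.

Theorem lemma23 (k : fieldType) (C : triCat k)
  (Hfin : hom_finite C) (HKS : krull_schmidt C) (HAR : has_AR_triangles C)
  (T : C) (Hfull : homT_full T) (Hdense : homT_dense T)
  (tau : C -> C) (Htau : AR_translation tau)
  (X Y : C) (f : mor (tau X) Y) (g : mor Y X) (h : mor X (Sigma (tau X)))
  (Delta : AR_triangle f g h)
  (HX : supported T X) (HtauX : supported T (tau X))
  (HSX : ~ in_add T (SigmaV X)) (HXT : ~ in_add T X) :
  AR_sequence (homT_map T f : {linear homT T (tau X) -> homT T Y})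
              (homT_map T g : {linear homT T Y -> homT T X}).
Proof.
split; first by split; apply: homT_fg.
split.
- exact: homT_short_exact Delta HSX HXT.
- exact: homT_left_almost_split HKS Hfull Hdense Delta HtauX.
- exact: homT_right_almost_split HKS Hfull Hdense Delta HX.
Qed.
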